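(* Let $H=(V,E)$ be a connected hypergraph without empty edges and $H'$ a hypersubgraph of $H$, and let $G=\mathcal{G}(H)$ and $G'=\mathcal{G}(H')$ be their incidence graphs. Then $H'$ is a block of $H$ if and only if $G'$ is a maximal cluster of blocks of $G$.
   Context: A hypergraph $H=(V,E)$ consists of a nonempty finite vertex set $V$, a finite edge set $E$, and an incidence function $\psi:E\to 2^V$; edges are identified with their vertex sets (parallel edges allowed); an empty edge has empty vertex set. Two distinct vertices are adjacent via $e$ if both lie in $e$; a walk is a sequence $v_0e_1v_1\dots e_kv_k$ with $v_{i-1},v_i$ adjacent via $e_i$; $H$ is connected if any two distinct vertices are joined by a walk. A hypersubgraph of $H$ is a hypergraph $(V',E')$ with $\emptyset\ne V'\subseteq V$, $E'\subseteq E$. A vertex $v$ is a separating vertex of a connected hypergraph $K$ without empty edges if there are two connected hypersubgraphs $K_1,K_2$ of $K$, each with at least one edge, with $E(K_1)\cap E(K_2)=\emptyset$, $V(K)=V(K_1)\cup V(K_2)$, $E(K)=E(K_1)\cup E(K_2)$, and $V(K_1)\cap V(K_2)=\{v\}$. A hypergraph is non-separable if it is connected, has no empty edges and no separating vertices; a block is a maximal non-separable hypersubgraph. The incidence graph $\mathcal{G}(H)$ is the bipartite graph with vertex set $V\cup E$ and edge set $\{ve: v\in e\}$; its vertices in $V$ are called v-vertices and those in $E$ e-vertices. Blocks of a graph are its maximal connected subgraphs without cut vertices (in the usual graph-theoretic sense). A cluster of blocks of $G$ is a connected union of blocks of $G$, no two of which share a v-vertex; a maximal cluster is one not properly contained in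 another cluster. *)

(* Defs.v *)
From HB Require Import structures.
From mathcomp Require Import all_boot.

Set Implicit Arguments.
Unset Strict Implicit.
Unset Printing Implicit Defensive.

(* A hypergraph whose vertices and edges are drawn from the finite types V and
   E. Keeping explicit vertex and edge sets lets a hypersubgraph be a hypergraph
   over the same V and E. The values of psi outside hedges are irrelevant: no
   notion below depends on them. *)
Record hypergraph (V E : finType) := Hypergraph {
  hverts : {set V};
  hedges : {set E};
  psi : E -> {set V};
  hverts_neq0 : hverts != set0;
  psi_sub : forall e, e \in hedges -> psi e \subset hverts }.

Section Hypergraphs.
Variables V E : finType.
Implicit Types H K : hypergraph V E.

Definition hadjacent_via H (e : E) (x y : V) : bool :=
  [&& e \in hedges H, x != y, x \in psi H e & y \in psi H e].

(* The walk v0 e1 v1 ... ek vk is the vertex v0 together with the sequence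
   [:: (e1, v1); ...; (ek, vk)]. *)
Fixpoint hwalk H (v0 : V) (p : seq (E * V)) : bool :=
  if p is (e, v) :: p' then hadjacent_via H e v0 v && hwalk H v p' else true.

Definition hconnected H : Prop :=
  {in hverts H &, forall x y, x != y ->
    exists2 p, hwalk H x p & last x [seq ev.2 | ev <- p] = y}.

Definition no_empty_edge H : Prop :=
  {in hedges H, forall e, psi H e != set0}.

Definition hypersubgraph K H : Prop :=
  [/\ hverts K \subset hverts H, hedges K \subset hedges H
    & {in hedges K, psi K =1 psi H}].

Definition separating_vertex K (v : V) : Prop :=
  exists K1 K2 : hypergraph V E,
  [/\ [/\ hypersubgraph K1 K, hconnected K1 & hedges K1 != set0],
      [/\ hypersubgraph K2 K, hconnected K2 & hedges K2 != set0],
      hedges K1 :&: hedges K2 = set0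
    & [/\ hverts K = hverts K1 :|: hverts K2,
          hedges K = hedges K1 :|: hedges K2
        & hverts K1 :&: hverts K2 = [set v]]].

Definition nonseparable K : Prop :=
  [/\ hconnected K, no_empty_edge K
    & forall v, v \in hverts K -> ~ separating_vertex K v].

(* hypersubgraph is antisymmetric only up to the irrelevant values of psi,
   whence maximality with respect to it as a preorder. *)
Definition hblock H K : Prop :=
  [/\ hypersubgraph K H, nonseparable K
    & forall K', hypersubgraph K' H -> nonseparable K' ->
        hypersubgraph K K' -> hypersubgraph K' K].

End Hypergraphs.

(* Simple graphs with vertices drawn from T: a vertex set and a set of edges,
   each edge being a 2-subset of the vertex set. The null graph is allowed, so
   that vertex deletion is total; it is not connected. *)
Record graph (T : finType) := Graph {
  gval : {set T} * {set {set T}};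
  gvalP : [forall e in gval.2, (#|e| == 2) && (e \subset gval.1)] }.

HB.instance Definition _ (T : finType) := [isSub for @gval T].
HB.instance Definition _ (T : finType) := [Finite of graph T by <:].

Section Graphs.
Variable T : finType.
Implicit Types B G : graph T.

Definition gverts G : {set T} := (gval G).1.
Definition gedges G : {set {set T}} := (gval G).2.

Definition gadj G : rel T := fun x y => [set x; y] \in gedges G.

Definition subgraph B G : bool :=
  (gverts B \subset gverts G) && (gedges B \subset gedges G).

Definition gconnected G : Prop :=
  gverts G != set0 /\ {in gverts G &, forall x y, connect (gadj G) x y}.

Fact gdel_subproof G (v : T) :
  let es := [set e in gedges G | v \notin e] in
  [forall e in es, (#|e| == 2) && (e \subset gverts G :\ v)].
Proof.
apply/forall_inP=> e; rewrite inE => /andP[eG ve].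
have /andP[-> sub] := forall_inP (gvalP G) e eG.
by rewrite subsetD1 sub.
Qed.

Definition gdel G (v : T) : graph T :=
  @Graph T (gverts G :\ v, [set e in gedges G | v \notin e]) (gdel_subproof G v).

Definition num_components G : nat := n_comp (gadj G) (gverts G).

Definition cut_vertex G (v : T) : bool :=
  (v \in gverts G) && (num_components G < num_components (gdel G v)).

Definition connected_no_cut G : Prop :=
  gconnected G /\ forall v, ~~ cut_vertex G v.

Definition gblock G B : Prop :=
  [/\ subgraph B G, connected_no_cut B
    & forall B', subgraph B' G -> connected_no_cut B' -> subgraph B B' ->
        B' = B].

End Graphs.

Section Incidence.
Variables V E : finType.

Definition incidence_verts (H : hypergraph V E) : {set V + E} :=
  [set inl v | v in hverts H] :|: [set inr e | e in hedges H].

Definition incidence_edges (H : hypergraph V E) : {set {set V + E}} :=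
  [set [set inl v; inr e] | e in hedges H, v in psi H e].

Fact incidence_subproof (H : hypergraph V E) :
  [forall a in incidence_edges H,
     (#|a| == 2) && (a \subset incidence_verts H)].
Proof.
apply/forall_inP=> a /imset2P[e v eH ve ->]; rewrite cards2 /=.
apply/subsetP=> x; rewrite !inE => /orP[] /eqP->.
  by rewrite imset_f // (subsetP (psi_sub eH)).
by rewrite orbC imset_f.
Qed.

(* The vertices inl v are the v-vertices, the vertices inr e the e-vertices. *)
Definition incidence_graph (H : hypergraph V E) : graph (V + E)%type :=
  @Graph _ (incidence_verts H, incidence_edges H) (incidence_subproof H).

Implicit Types G C : graph (V + E)%type.

Definition cluster G C : Prop :=
  exists F : {set graph (V + E)%type},
  [/\ forall B, B \in F -> gblock G B,
      gverts C = \bigcup_(B in F) gverts B,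
      gedges C = \bigcup_(B in F) gedges B,
      gconnected C
    & {in F &, forall B1 B2, B1 != B2 ->
        forall v : V, ~ (inl v \in gverts B1 /\ inl v \in gverts B2)}].

Definition maximal_cluster G C : Prop :=
  cluster G C /\ forall C', cluster G C' -> subgraph C C' -> C' = C.

End Incidence.

(* Main.v *)
(* Fix a set P of vertices of a graph G and call a connected vertex set S
   P-uncut if no vertex of P separates G[S]; for P everything, the maximal such
   sets are the vertex sets of the blocks of G. A cluster is uncut by v-vertices,
   since each v-vertex lies in only one of its blocks. Conversely, a maximal set
   S uncut by v-vertices induces a cluster: S absorbs each block meeting it in an
   edge, and two neighbours of a v-vertex v in S are joined by a path in S - v,
   so a cycle through v puts them in the same block. Hence the maximal clusters
   are the subgraphs induced by the maximal sets uncut by v-vertices. On the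
   other side, the separating vertices of a hypergraph are the v-vertices that
   cut its incidence graph, and a set uncut by v-vertices remains so when all the
   vertices of its hyperedges are added, so the same sets describe the blocks of
   H. *)
Require Import Defs.
From mathcomp Require Import all_boot.

Set Implicit Arguments.
Unset Strict Implicit.
Unset Printing Implicit Defensive.

(** Induction along a walk. [Q] takes values in [Prop] because some invariants below are existential
    statements. *)
Lemma connect_invariant (T : finType) (e : rel T) (Q : T -> Prop) x y :
  (forall z t, e z t -> Q z -> Q t) -> connect e x y -> Q x -> Q y.
Proof.
move=> stepQ /connectP[p ep ->] {y}.
elim: p x ep => //= z p IHp x /andP[exz ep] Qx.
exact: IHp ep (stepQ _ _ exz Qx).
Qed.

(** * Connectivity within a vertex set *)

Section SetConnectivity.
Variable T : finType.
Implicit Types (G B : graph T) (S A : {set T}) (P : pred T).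

Lemma gadj_sym G : symmetric (gadj G).
Proof. by move=> x y; rewrite /gadj setUC. Qed.

Lemma gadj_neq G x y : gadj G x y -> x != y.
Proof.
rewrite /gadj => exy; have /andP[] := forall_inP (gvalP G) _ exy.
by rewrite cards2; case: (x != y).
Qed.

Lemma gadj_verts G x y : gadj G x y -> (x \in gverts G) && (y \in gverts G).
Proof.
rewrite /gadj => exy; have /andP[_ /subsetP sub] := forall_inP (gvalP G) _ exy.
by rewrite !sub ?set21 ?set22.
Qed.

(** Adjacency in G[S], kept as a relation on all of [T] so that varying [S] changes neither the type
    nor the graph. *)
Definition adj_in G S : rel T := [rel x y in S | gadj G x y].

(** The empty set counts as connected, so deleting the only vertex of a singleton does not
    disconnect it. *)
Definition sconn G S : bool :=
  [forall x in S, forall y in S, connect (adj_in G S) x y].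

Lemma sconnP G S :
  reflect {in S &, forall x y, connect (adj_in G S) x y} (sconn G S).
Proof.
apply: (iffP forall_inP) => [cS x y xS yS | cS x xS].
  exact: (forall_inP (cS x xS)).
by apply/forall_inP=> y; apply: cS.
Qed.

Lemma adj_inP G S x y :
  reflect [/\ x \in S, y \in S & gadj G x y] (adj_in G S x y).
Proof.
by rewrite /adj_in /= -andbA; apply: (iffP and3P) => [[]|[]].
Qed.

Lemma connect_adj_in_sym G S : connect_sym (adj_in G S).
Proof.
apply: sym_connect_sym => x y; apply/adj_inP/adj_inP=> -[? ?];
by rewrite gadj_sym.
Qed.

Lemma connect_adj_inS G S A :
  S \subset A -> subrel (connect (adj_in G S)) (connect (adj_in G A)).
Proof.
move=> /subsetP SA; apply: connect_sub => x y /adj_inP[xS yS exy].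
by apply: connect1; apply/adj_inP; split; rewrite ?SA.
Qed.

Lemma sconn_center G S x :
  (forall y, y \in S -> connect (adj_in G S) x y) -> sconn G S.
Proof.
move=> cS; apply/sconnP=> y z yS zS.
by apply: connect_trans (cS z zS); rewrite connect_adj_in_sym cS.
Qed.

Lemma sconnU G S A z :
  z \in S -> z \in A -> sconn G S -> sconn G A -> sconn G (S :|: A).
Proof.
move=> zS zA /sconnP cS /sconnP cA; apply: (@sconn_center _ _ z) => y.
case/setUP=> [yS|yA]; last exact: connect_adj_inS (subsetUr _ _) _ _ (cA _ _ zA yA).
exact: connect_adj_inS (subsetUl _ _) _ _ (cS _ _ zS yS).
Qed.

Lemma sconn_neighbour G S x y :
  sconn G S -> x \in S -> y \in S -> x != y -> exists2 z, z \in S & gadj G x z.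
Proof.
move=> /sconnP cS xS yS; have /connectP[[|z p] /=] := cS x y xS yS.
  by move=> _ ->; rewrite eqxx.
by case/andP=> /adj_inP[_ zS exz] _ _ _; exists z.
Qed.

(** Each vertex of [A] outside [S] hangs on a vertex of [S], through which it is reached from a
    fixed vertex of [S]. *)
Lemma sconn_pendant G S A :
  S \subset A -> sconn G S ->
  (forall x, x \in A -> x \notin S -> exists2 y, y \in S & gadj G x y) ->
  S != set0 -> sconn G A.
Proof.
move=> SA /sconnP cS pend /set0Pn[z zS]; apply: (@sconn_center _ _ z) => x xA.
have toS y : y \in S -> connect (adj_in G A) z y.
  by move=> yS; apply: connect_adj_inS SA _ _ (cS _ _ zS yS).
have [|xS] := boolP (x \in S); first exact: toS.
have [y yS exy] := pend x xA xS; apply: connect_trans (toS y yS) (connect1 _).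
by apply/adj_inP; rewrite gadj_sym (subsetP SA y yS).
Qed.

(* A connected graph stays connected when some of the components left by the
   deletion of v are dropped. *)
Lemma sconn_components G S A v :
  sconn G S -> v \in S -> A \subset S ->
  (forall x y, x \in A -> y \in S -> y != v -> gadj G x y -> y \in A) ->
  sconn G (v |: A).
Proof.
move=> /sconnP cS vS AS closedA; apply: (@sconn_center _ _ v) => z.
case/setU1P=> [->|zA]; first exact: connect0.
rewrite connect_adj_in_sym.
(* Along a walk from [z] to [v] in [S], closure keeps the walk in [A] until it first meets [v]. *)
pose Q t := connect (adj_in G (v |: A)) z v \/
  (t \in v |: A) && connect (adj_in G (v |: A)) z t.
have : Q v.
  apply: connect_invariant (cS z v (subsetP AS z zA) vS) _; last first.
    by right; rewrite connect0 setU1r.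
  move=> x y /adj_inP[xS yS exy] [zv|/andP[xvA zx]]; first by left.
  have [xv|xv] := eqVneq x v; first by left; move: zx; rewrite xv.
  have xA : x \in A by move: xvA; case/setU1P=> // e; rewrite e eqxx in xv.
  have yA : y \in v |: A.
    by rewrite !inE; have [//|yv] := eqVneq y v; apply: closedA exy.
  by right; rewrite yA (connect_trans zx) //; apply: connect1; apply/adj_inP.
by case=> // /andP[].
Qed.

(** * Induced subgraphs *)

Fact induced_subproof G S :
  [forall e in [set e in gedges G | e \subset S],
     (#|e| == 2) && (e \subset gverts G :&: S)].
Proof.
apply/forall_inP=> e; rewrite inE => /andP[eG eS].
by have /andP[-> sub] := forall_inP (gvalP G) e eG; rewrite subsetI sub.
Qed.

Definition induced G S : graph T :=
  @Graph T (gverts G :&: S, [set e in gedges G | e \subset S])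
    (induced_subproof G S).

Lemma gverts_induced G S : S \subset gverts G -> gverts (induced G S) = S.
Proof. by move/setIidPr. Qed.

Lemma gedges_induced G S e :
  (e \in gedges (induced G S)) = (e \in gedges G) && (e \subset S).
Proof. by rewrite inE. Qed.

Lemma gadj_induced G S : gadj (induced G S) =2 adj_in G S.
Proof.
move=> x y; rewrite /adj_in /gadj gedges_induced subUset !sub1set /=.
by rewrite andbC.
Qed.

Lemma gadj_gdel B v x y :
  gadj (gdel B v) x y = [&& gadj B x y, x != v & y != v].
Proof. by rewrite /gadj inE !inE negb_or ![v == _]eq_sym. Qed.

Lemma graph_eqP B1 B2 : gverts B1 = gverts B2 -> gedges B1 = gedges B2 -> B1 = B2.
Proof.
rewrite /gverts /gedges => eqv eqe; apply: val_inj.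
by rewrite /= [LHS]surjective_pairing [RHS]surjective_pairing eqv eqe.
Qed.

Lemma subgraph_gadj B G : subgraph B G -> subrel (gadj B) (gadj G).
Proof. by case/andP=> _ /subsetP sub x y; apply: sub. Qed.

Lemma subgraph_induced B G S :
  subgraph B G -> gverts B \subset S -> subgraph B (induced G S).
Proof.
case/andP=> vBG /subsetP eBG vBS; apply/andP; split; first by rewrite subsetI vBG.
apply/subsetP=> e eB; rewrite gedges_induced eBG //.
by have /andP[_ /subset_trans->] := forall_inP (gvalP B) e eB.
Qed.

Lemma induced_subgraph G S : subgraph (induced G S) G.
Proof.
rewrite /subgraph subsetIl; apply/subsetP=> e.
by rewrite gedges_induced => /andP[].
Qed.

Lemma subgraph_antisym B1 B2 : subgraph B1 B2 -> subgraph B2 B1 -> B1 = B2.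
Proof.
case/andP=> v12 e12 /andP[v21 e21].
by apply: graph_eqP; apply/eqP; rewrite eqEsubset ?v12 ?e12.
Qed.

(** * Components and cut vertices *)

Lemma root_verts B x : x \in gverts B -> root (gadj B) x \in gverts B.
Proof.
move=> xB; pose Q z : Prop := z \in gverts B.
by apply: (@connect_invariant _ _ Q) (connect_root _ x) xB => s t /gadj_verts/andP[].
Qed.

(** [n_comp] counts the roots lying in [gverts B]. The root of a vertex of [B] is again in [B], and
    two vertices are connected exactly when their roots agree. *)
Lemma num_components_le1P B :
  reflect {in gverts B &, forall x y, connect (gadj B) x y}
    (num_components B <= 1).
Proof.
have symB : connect_sym (gadj B) by apply/sym_connect_sym/gadj_sym.
apply: (iffP card_le1_eqP) => [eqr x y xB yB | cB x y].
  have rootsB z : z \in gverts B ->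
      root (gadj B) z \in [predI roots (gadj B) & gverts B].
    by move=> zB; apply/andP; split; [exact: roots_root | exact: root_verts].
  by rewrite -root_connect //; apply/eqP/eqr; exact: rootsB.
rewrite !inE => /andP[/eqP xr xB] /andP[/eqP yr yB].
by rewrite -xr -yr; apply/eqP; rewrite root_connect // cB.
Qed.

Lemma num_components_gt0 B x : x \in gverts B -> 0 < num_components B.
Proof.
have symB : connect_sym (gadj B) by apply/sym_connect_sym/gadj_sym.
move=> xB; apply/card_gt0P; exists (root (gadj B) x).
by apply/andP; split; [exact: roots_root | exact: root_verts].
Qed.

Lemma gconnected_sconn G B :
  subgraph B G -> gconnected B -> sconn G (gverts B).
Proof.
move=> BG [_ cB]; apply/sconnP=> x y xB yB.
apply: connect_sub (cB x y xB yB) => s t st; apply: connect1; apply/adj_inP.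
by have /andP[sB tB] := gadj_verts st; rewrite sB tB (subgraph_gadj BG).
Qed.

(** A connected [B] has at most one component, hence so has [gdel B v] when [v] is not a cut vertex.
    If [v] is outside [B], nothing is deleted. *)
Lemma gdel_sconn G B v :
  subgraph B G -> gconnected B -> ~~ cut_vertex B v -> sconn G (gverts B :\ v).
Proof.
move=> BG cB; rewrite negb_and; case/orP=> [vB|].
  by rewrite (setDidPl _) ?disjoints1 ?gconnected_sconn // disjoint_sym disjoints1.
rewrite -leqNgt => le; have le1 : num_components (gdel B v) <= 1.
  by apply: leq_trans le _; apply/num_components_le1P; case: cB.
apply/sconnP=> x y xB yB.
apply: connect_sub (num_components_le1P _ le1 x y xB yB) => s t.
rewrite gadj_gdel => /and3P[st sv tv]; apply: connect1; apply/adj_inP.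
have /andP[sB tB] := gadj_verts st.
by rewrite !inE sv tv sB tB (subgraph_gadj BG).
Qed.

Lemma induced_gconnected G S :
  S \subset gverts G -> S != set0 -> sconn G S -> gconnected (induced G S).
Proof.
move=> SG S0 /sconnP cS; split; rewrite gverts_induced // => x y xS yS.
by rewrite (eq_connect (gadj_induced G S)) cS.
Qed.

(** Deleting [v] leaves at most one component, and a graph containing [v] has at least one, so the
    count cannot grow. *)
Lemma induced_no_cut G S v :
  S \subset gverts G -> sconn G (S :\ v) -> ~~ cut_vertex (induced G S) v.
Proof.
move=> SG /sconnP cSv; rewrite /cut_vertex gverts_induced //.
have [vS|//] := boolP (v \in S); rewrite /= -leqNgt.
apply: (@leq_trans 1); last by apply: (@num_components_gt0 _ v); rewrite gverts_induced.
have vertsE : gverts (gdel (induced G S) v) = S :\ v.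
  by rewrite {1}/gverts /= gverts_induced.
apply/num_components_le1P=> x y; rewrite vertsE => xS yS.
apply: connect_sub (cSv x y xS yS) => s t /adj_inP[/setD1P[sv sS] /setD1P[tv tS] st].
apply: connect1; rewrite gadj_gdel gadj_induced sv tv !andbT.
exact/adj_inP.
Qed.

(** * Uncut sets *)

(** For [u] outside [S], the last condition just repeats the connectedness of [S]. *)
Definition nocut G P S : bool :=
  [&& S \subset gverts G, S != set0, sconn G S
    & [forall u in P, sconn G (S :\ u)]].

Lemma nocutP G P S :
  reflect [/\ S \subset gverts G, S != set0, sconn G S
            & forall u, P u -> sconn G (S :\ u)]
    (nocut G P S).
Proof.
by apply: (iffP and4P) => -[? ? ? cut]; split=> //; apply/forall_inP.
Qed.

Lemma nocut_predT G P S : nocut G predT S -> nocut G P S.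
Proof. by case/nocutP=> SG S0 cS cut; apply/nocutP; split=> // u _; apply: cut. Qed.

(** Whichever vertex is deleted, one of the two common vertices survives and joins what remains of
    [S] and [A]. *)
Lemma nocutU G P S A x y :
  nocut G P S -> nocut G P A -> x != y ->
  x \in S -> y \in S -> x \in A -> y \in A -> nocut G P (S :|: A).
Proof.
case/nocutP=> SG S0 cS cutS /nocutP[AG A0 cA cutA] xy xS yS xA yA.
apply/nocutP; split; rewrite ?subUset ?SG //.
- by rewrite setU_eq0 negb_and S0.
- exact: sconnU xS xA cS cA.
move=> u Pu; rewrite setDUl; have [xu|xu] := eqVneq x u.
  by apply: (@sconnU _ _ _ y); rewrite ?cutS ?cutA // !inE -xu eq_sym xy.
by apply: (@sconnU _ _ _ x); rewrite ?cutS ?cutA // !inE xu.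
Qed.

Lemma path_sconn G A x p :
  path (gadj G) x p -> A =i x :: p -> sconn G A.
Proof.
move=> ep AE; have sub z : z \in x :: p -> z \in A by rewrite AE.
apply: (@sconn_center _ _ x) => y; rewrite AE; apply: path_connect.
elim: p x ep sub {AE} => //= z p IHp x /andP[exz ep] sub; apply/andP; split.
  by apply/adj_inP; rewrite !sub ?inE ?eqxx ?orbT.
by apply: IHp => // t tp; apply: sub; rewrite inE tp orbT.
Qed.

(** Deleting one vertex of a cycle leaves a path. Two vertices joined by an edge also count as a
    cycle here, with the edge run back and forth. *)
Lemma cycle_nocut G P v p :
  cycle (gadj G) (v :: p) -> uniq (v :: p) -> {subset v :: p <= gverts G} ->
  nocut G P [set x in v :: p].
Proof.
move=> cyc uni sub; apply/nocutP; split.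
- by apply/subsetP=> x; rewrite inE; apply: sub.
- by apply/set0Pn; exists v; rewrite inE mem_head.
- apply: (@path_sconn _ _ v p); last by move=> z; rewrite inE.
  by move: cyc; rewrite /= rcons_path => /andP[].
move=> u _; have [up|up] := boolP (u \in v :: p); last first.
  apply: (@path_sconn _ _ v p).
    by move: cyc; rewrite /= rcons_path => /andP[].
  move=> z; rewrite !inE; case: eqVneq => //= ->.
  by move: up; rewrite inE => /negbTE.
(* Rotated to start at [u], the cycle leaves the path [q] once [u] is deleted. *)
have [i q eq_rot] := rot_to up.
have memq z : (z \in v :: p) = (z \in u :: q) by rewrite -eq_rot mem_rot.
move: cyc uni; rewrite -(rot_cycle i) -(rot_uniq i) eq_rot /= => cyc /andP[uq _].
have setE z : (z \in [set x in v :: p] :\ u) = (z \in q).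
  rewrite in_setD1 inE memq inE; case: eqVneq => //= ->.
  by rewrite (negbTE uq).
case: q cyc {eq_rot memq} uq setE => [|w q] cyc uq setE.
  by apply/sconnP=> x y; rewrite setE.
apply: (@path_sconn _ _ w q) => //.
by move: cyc; rewrite /= rcons_path => /andP[_ /andP[]].
Qed.

Lemma edge_nocut G P x y : gadj G x y -> nocut G P [set x; y].
Proof.
move=> exy; have /andP[xG yG] := gadj_verts exy.
have -> : [set x; y] = [set z in [:: x; y]] by apply/setP=> z; rewrite !inE.
apply: cycle_nocut; rewrite /= ?exy 1?gadj_sym ?exy // ?inE ?(gadj_neq exy) //.
by move=> z; rewrite !inE => /orP[]/eqP->.
Qed.

(** The union with [S] is again uncut, so maximality absorbs [A]. *)
Lemma maxset_nocut_overlap G P S A x y :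
  maxset (nocut G P) S -> nocut G P A -> x != y ->
  x \in S -> y \in S -> x \in A -> y \in A -> A \subset S.
Proof.
move=> /maxsetP[ncS maxS] ncA xy xS yS xA yA.
by rewrite -(maxS _ (nocutU ncS ncA xy xS yS xA yA)) ?subsetUl ?subsetUr.
Qed.

(** * Blocks inside a maximal uncut set *)

(** Extend the edge to a maximal [predT]-uncut set. It is also [P]-uncut and shares two vertices
    with [S], so [S] absorbs it. *)
Lemma edge_in_block G P S x y :
  maxset (nocut G P) S -> x \in S -> y \in S -> gadj G x y ->
  exists A, [/\ maxset (nocut G predT) A, A \subset S, x \in A & y \in A].
Proof.
move=> maxS xS yS exy.
have [A maxA /subsetP sub] := maxset_exists (edge_nocut predT exy).
have [xA yA] : x \in A /\ y \in A by rewrite !sub ?set21 ?set22.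
exists A; split=> //.
have ncA : nocut G P A by apply: nocut_predT; case/maxsetP: maxA.
exact: maxset_nocut_overlap maxS ncA (gadj_neq exy) xS yS xA yA.
Qed.

Lemma vertex_in_block G P S x :
  maxset (nocut G P) S -> x \in S ->
  exists A, [/\ maxset (nocut G predT) A, A \subset S & x \in A].
Proof.
move=> maxS xS; have [ncS bigS] := maxsetP maxS.
have [SG S0 cS cut] := nocutP _ _ _ ncS.
(* A singleton [S] is itself a block: a larger [predT]-uncut set would be [P]-uncut, against
   maximality. Otherwise [x] lies on an edge inside [S]. *)
have [eqS|] := eqVneq S [set x].
  exists S; split=> //; apply/maxsetP; split.
    apply/nocutP; split=> // u _; apply/sconnP=> y z.
    rewrite eqS !inE => /andP[yu /eqP yx] /andP[_ /eqP->].
    by rewrite yx connect0.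
  by move=> A /nocut_predT ncA SA; apply: bigS.
rewrite eqEsubset sub1set xS andbT => /subsetPn[y yS]; rewrite inE eq_sym => xy.
have [z zS exz] := sconn_neighbour cS xS yS xy.
by have [A [? ? ? _]] := edge_in_block maxS xS zS exz; exists A.
Qed.

(** Neighbours of [v] in [A1] and in [A2] are joined by a path avoiding [v]. Closed up through [v],
    it is a cycle that both sets absorb, so they overlap in two vertices and coincide. *)
Lemma blocks_at_uncut_vertex G P S A1 A2 v :
  nocut G P S -> P v -> maxset (nocut G predT) A1 -> maxset (nocut G predT) A2 ->
  A1 \subset S -> A2 \subset S -> v \in A1 -> v \in A2 -> A1 = A2.
Proof.
move=> ncS Pv max1 max2 A1S A2S v1 v2.
have [nc1 big1] := maxsetP max1; have [nc2 big2] := maxsetP max2.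
(* If [A1] is just [v], it lies in [A2] and equals it by maximality. *)
have [eq1|] := eqVneq A1 [set v].
  by rewrite (big1 _ nc2) // eq1 sub1set.
rewrite eqEsubset sub1set v1 andbT => /subsetPn[y1 yA1]; rewrite inE eq_sym => vy1.
have [eq2|] := eqVneq A2 [set v].
  by rewrite (big2 _ nc1) // eq2 sub1set.
rewrite eqEsubset sub1set v2 andbT => /subsetPn[y2 yA2]; rewrite inE eq_sym => vy2.
have [_ _ c1 _] := nocutP _ _ _ nc1; have [_ _ c2 _] := nocutP _ _ _ nc2.
have [x1 x1A vx1] := sconn_neighbour c1 v1 yA1 vy1.
have [x2 x2A vx2] := sconn_neighbour c2 v2 yA2 vy2.
have [SG _ _ /(_ v Pv)/sconnP cSv] := nocutP _ _ _ ncS.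
have xin1 : x1 \in S :\ v by rewrite in_setD1 eq_sym (gadj_neq vx1) (subsetP A1S).
have xin2 : x2 \in S :\ v by rewrite in_setD1 eq_sym (gadj_neq vx2) (subsetP A2S).
have /connectP[p0 ep0 eqx2] := cSv x1 x2 xin1 xin2.
(* The path is made simple so that closing it through [v] gives a cycle without repetition. *)
move: eqx2; case: (shortenP ep0) => p ep uni _ eqx2.
have sub z : z \in x1 :: p -> z \in S :\ v.
  rewrite inE => /orP[/eqP->//|].
  elim: p x1 {ep0 eqx2 uni x1A vx1 xin1} ep => //= t p IHp x1.
  case/andP=> /adj_inP[_ tS _] tp; rewrite inE => /orP[/eqP->//|]; exact: IHp tp.
pose C := [set x in v :: x1 :: p].
have [vC x1C] : v \in C /\ x1 \in C by rewrite !inE !eqxx orbT.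
have x2C : x2 \in C by rewrite inE eqx2 inE mem_last orbT.
have ncC : nocut G predT C.
  apply: cycle_nocut.
  - rewrite /= vx1 rcons_path -eqx2 gadj_sym vx2 andbT.
    by apply: sub_path ep => s t /adj_inP[].
  - rewrite cons_uniq uni andbT; apply/negP=> /sub.
    by rewrite !inE eqxx.
  move=> z; rewrite inE => /orP[/eqP->|/sub].
    by apply: (subsetP SG); apply: (subsetP A1S).
  by rewrite in_setD1 => /andP[_ zS]; apply: (subsetP SG).
have C1 := maxset_nocut_overlap max1 ncC (gadj_neq vx1) v1 x1A vC x1C.
have C2 := maxset_nocut_overlap max2 ncC (gadj_neq vx2) v2 x2A vC x2C.
have x12 := subsetP C2 x1 x1C.
apply/eqP; rewrite eqEsubset.
rewrite (maxset_nocut_overlap max2 nc1 (gadj_neq vx1)) //.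
by rewrite (maxset_nocut_overlap max1 nc2 (gadj_neq vx1)).
Qed.

(** A connected graph without cut vertices containing G[S] has an uncut vertex set, which is [S] by
    maximality, so it is contained in G[S]. *)
Lemma maxset_gblock G S :
  maxset (nocut G predT) S -> gblock G (induced G S).
Proof.
move=> /maxsetP[ncS bigS]; have [SG S0 cS cut] := nocutP _ _ _ ncS.
split; first exact: induced_subgraph.
  split; first exact: induced_gconnected.
  by move=> v; apply: induced_no_cut => //; apply: cut.
move=> B BG [cB cutB] SB; have /andP[vBG _] := BG.
have vS : gverts B = S.
  apply: bigS; last by move: SB; rewrite /subgraph gverts_induced // => /andP[].
  apply/nocutP; split=> //; first by case: cB.
    exact: gconnected_sconn.
  by move=> u _; apply: gdel_sconn.
by apply: subgraph_antisym SB; apply: subgraph_induced; rewrite ?vS.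
Qed.

End SetConnectivity.

(** * Clusters and sets uncut by v-vertices *)

Section Clusters.
Variables V E : finType.
Implicit Types (G B C : graph (V + E)%type) (S A : {set V + E}).

Definition v_vertex : pred (V + E)%type := fun x => if x is inl _ then true else false.

Lemma cluster_subgraph G C : cluster G C -> subgraph C G.
Proof.
case=> F [blF vC eC _ _]; apply/andP; rewrite vC eC.
by split; apply/bigcupsP=> B /blF[/andP[]].
Qed.

Lemma cluster_nocut G C : cluster G C -> nocut G v_vertex (gverts C).
Proof.
move=> clC; have CG := cluster_subgraph clC; have /andP[vCG _] := CG.
case: clC => F [blF vC eC cC disj].
apply/nocutP; split=> //; [by case: cC | exact: gconnected_sconn |].
case=> // v _; set u := inl v.
have [uC|uC] := boolP (u \in gverts C); last first.
  by rewrite (setDidPl _) ?gconnected_sconn // disjoint_sym disjoints1.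
have [B BF uB] : exists2 B, B \in F & u \in gverts B.
  by move: uC; rewrite vC => /bigcupP.
have [BG [cB /(_ u) cutB] _] := blF B BF.
have /sconnP cBu := gdel_sconn BG cB cutB.
have BCu : gverts B :\ u \subset gverts C :\ u.
  by rewrite setSD // vC bigcup_sup.
(* Every edge of [C] at [u] lies in a block of the family that contains [u], and only [B] does. *)
have inB z : gadj C u z -> z \in gverts B :\ u.
  move=> uz; rewrite in_setD1 eq_sym (gadj_neq uz) /=.
  have : [set u; z] \in gedges C by [].
  rewrite eC => /bigcupP[B' B'F uz'].
  have /andP[uB' zB'] : (u \in gverts B') && (z \in gverts B') by apply: gadj_verts uz'.
  have [<- //|BB'] := eqVneq B' B.
  by case: (disj B' B B'F BF BB' v).
apply/sconnP=> x y; set R := connect _ => xC yC.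
(* A walk through u enters and leaves u inside the only block of the cluster
   at u, which the deletion of u leaves connected. *)
pose Q z := if z == u then exists2 w, w \in gverts B :\ u & R x w else R x z : Prop.
have : Q y.
  move: (xC) (yC); rewrite !in_setD1 => /andP[xu xC'] /andP[_ yC'].
  apply: connect_invariant (proj2 cC x y xC' yC') _; last first.
    by rewrite /Q (negbTE xu); apply: connect0.
  rewrite /Q => s t st; have /andP[sC tC] := gadj_verts st.
  have [su|su] := eqVneq s u; have [tu|tu] := eqVneq t u => //.
  - case=> w wB xw; rewrite su in st; apply: connect_trans xw _.
    exact: connect_adj_inS BCu _ _ (cBu _ _ wB (inB _ st)).
  - by move=> xs; exists s => //; apply: inB; rewrite gadj_sym -tu.
  move=> xs; apply: connect_trans xs (connect1 _); apply/adj_inP.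
  by rewrite !in_setD1 su tu sC tC (subgraph_gadj CG).
by rewrite /Q; move: yC; rewrite in_setD1 => /andP[/negbTE-> _].
Qed.

(** The family consists of all blocks with vertex set inside [S]. They cover the vertices and edges
    of G[S], and two of them meeting in a v-vertex coincide. *)
Lemma maxset_cluster G S : maxset (nocut G v_vertex) S -> cluster G (induced G S).
Proof.
move=> maxS; have [ncS _] := maxsetP maxS; have [SG S0 cS _] := nocutP _ _ _ ncS.
have maxG A : maxset (nocut G predT) A -> gverts (induced G A) = A.
  by case/maxsetP=> /nocutP[AG _ _ _] _; apply: gverts_induced.
exists [set induced G A | A : {set V + E} & maxset (nocut G predT) A && (A \subset S)].
split.
- by move=> B /imsetP[A]; rewrite inE => /andP[maxA _] ->; apply: maxset_gblock.
- rewrite gverts_induced //; apply/setP=> x; apply/idP/bigcupP.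
    move=> xS; have [A [maxA AS xA]] := vertex_in_block maxS xS.
    by exists (induced G A); rewrite ?maxG // imset_f // inE maxA.
  case=> B /imsetP[A]; rewrite inE => /andP[maxA AS] ->.
  by rewrite maxG //; apply: (subsetP AS).
- apply/setP=> a; apply/idP/bigcupP; last first.
    case=> B /imsetP[A]; rewrite inE => /andP[_ AS] ->.
    by rewrite !gedges_induced => /andP[-> /subset_trans->].
  rewrite gedges_induced => /andP[aG aS].
  have /andP[/cards2P[x [y [xy aE]]] _] := forall_inP (gvalP G) a aG.
  move: aG aS; rewrite aE subUset !sub1set => exy /andP[xS yS].
  have [A [maxA AS xA yA]] := edge_in_block maxS xS yS exy.
  exists (induced G A).
    by apply/imsetP; exists A; rewrite // inE maxA.
  by rewrite gedges_induced exy subUset !sub1set xA.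
- exact: induced_gconnected.
move=> B1 B2 /imsetP[A1]; rewrite inE => /andP[max1 A1S] ->.
move=> /imsetP[A2]; rewrite inE => /andP[max2 A2S] -> neq v.
rewrite !maxG // => -[v1 v2]; case/eqP: neq; congr induced.
exact: (blocks_at_uncut_vertex ncS (v := inl v)).
Qed.

(** Vertex sets of clusters are uncut by v-vertices, and maximal uncut sets induce clusters, so
    maximality passes both ways. *)
Lemma maximal_clusterP G S :
  S \subset gverts G ->
  maximal_cluster G (induced G S) <-> maxset (nocut G v_vertex) S.
Proof.
move=> SG; have vS := gverts_induced SG; split=> [[clS maxS]|maxS].
  have := cluster_nocut clS; rewrite vS => /maxset_exists[A maxA SA].
  have [/nocutP[AG _ _ _] _] := maxsetP maxA.
  suff <- : A = S by [].
  rewrite -vS -(maxS _ (maxset_cluster maxA)) ?gverts_induced //.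
  by apply: subgraph_induced (induced_subgraph G S) _; rewrite vS.
split; first exact: maxset_cluster.
have [_ bigS] := maxsetP maxS.
move=> C clC SC; apply: subgraph_antisym (SC).
apply: subgraph_induced; first exact: cluster_subgraph.
rewrite (bigS _ (cluster_nocut clC)) //.
by case/andP: SC; rewrite vS.
Qed.

End Clusters.

(** * Incidence graphs of hypersubgraphs *)

Section Incidence.
Variables V E : finType.
Implicit Types (H K : hypergraph V E) (S A : {set V + E}).

Lemma inl_incidence K v : (inl v \in incidence_verts K) = (v \in hverts K).
Proof.
rewrite in_setU mem_imset; last by move=> x y [].
by rewrite orbC; case: imsetP => // -[].
Qed.

Lemma inr_incidence K e : (inr e \in incidence_verts K) = (e \in hedges K).
Proof.
rewrite in_setU [X in _ || X]mem_imset; last by move=> x y [].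
by case: imsetP => // -[].
Qed.

Definition inE_incidence := (inl_incidence, inr_incidence).

Lemma gadj_lr K v e :
  gadj (incidence_graph K) (inl v) (inr e) = (e \in hedges K) && (v \in psi K e).
Proof.
apply/imset2P/andP=> [[e' v' e'K v'e' /setP eqs]|[eK ve]]; last by exists e v.
have := eqs (inl v'); have := eqs (inr e'); rewrite !inE /= !eqxx /=.
by move=> /eqP[<-]; rewrite orbF => /eqP[<-].
Qed.

Lemma gadj_rl K v e :
  gadj (incidence_graph K) (inr e) (inl v) = (e \in hedges K) && (v \in psi K e).
Proof. by rewrite gadj_sym gadj_lr. Qed.

Lemma gadj_ll K v w : gadj (incidence_graph K) (inl v) (inl w) = false.
Proof. by apply/imset2P=> -[e u _ _ /setP/(_ (inr e))]; rewrite !inE /= eqxx. Qed.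

Lemma gadj_rr K e f : gadj (incidence_graph K) (inr e) (inr f) = false.
Proof. by apply/imset2P=> -[g u _ _ /setP/(_ (inl u))]; rewrite !inE /= eqxx. Qed.

Definition gadj_incidence := (gadj_lr, gadj_rl, gadj_ll, gadj_rr).

Lemma incidence_sub K H :
  hypersubgraph K H -> incidence_verts K \subset incidence_verts H.
Proof.
case=> /subsetP vKH /subsetP eKH _; apply/subsetP=> -[v|e];
by rewrite !inE_incidence; auto.
Qed.

(** Both incidence functions agree with that of [H], so comparing vertices and edges suffices. *)
Lemma sub_hypersubgraph H K1 K2 :
  hypersubgraph K1 H -> hypersubgraph K2 H ->
  incidence_verts K1 \subset incidence_verts K2 -> hypersubgraph K1 K2.
Proof.
case=> _ _ psi1 [_ _ psi2] /subsetP sub; split.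
- by apply/subsetP=> v; have := sub (inl v); rewrite !inE_incidence.
- by apply/subsetP=> e; have := sub (inr e); rewrite !inE_incidence.
move=> e e1; rewrite psi1 // psi2 //.
by have := sub (inr e); rewrite !inE_incidence; apply.
Qed.

(** A hyperedge kept in [K] keeps all its vertices, so no incidence between elements of [K] is
    lost. *)
Lemma incidence_induced H K :
  hypersubgraph K H ->
  incidence_graph K = induced (incidence_graph H) (incidence_verts K).
Proof.
move=> KH; have [_ /subsetP eKH psiK] := KH.
apply: graph_eqP; first by rewrite gverts_induced // incidence_sub.
apply/setP=> a; rewrite gedges_induced; apply/imset2P/andP.
  case=> e v eK ve ->; rewrite subUset !sub1set !inE_incidence eK.
  rewrite (subsetP (psi_sub eK)) //; split=> //.
  by apply/imset2P; exists e v; rewrite ?eKH // -psiK.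
case=> /imset2P[e v eH ve ->]; rewrite subUset !sub1set !inE_incidence.
by case/andP=> _ eK; exists e v; rewrite ?psiK.
Qed.

Lemma hwalk_rcons K x p e y :
  hwalk K x (rcons p (e, y)) =
  hwalk K x p && hadjacent_via K e (last x [seq ev.2 | ev <- p]) y.
Proof.
by elim: p x => [|[f z] p IHp] x /=; rewrite ?andbT // IHp andbA.
Qed.

(** * Connectedness, separation and blocks of hypergraphs *)

Section Subhypergraphs.
Variable H : hypergraph V E.
Hypothesis H_no_empty : no_empty_edge H.
Local Notation G := (incidence_graph H).

Lemma no_empty_edge_sub K : hypersubgraph K H -> no_empty_edge K.
Proof. by case=> _ /subsetP eKH psiK e eK; rewrite psiK // H_no_empty ?eKH. Qed.

(** As no edge is empty, a nonempty [S] closed under taking the vertices of its hyperedges contains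
    a v-vertex, as a hypergraph requires. *)
Lemma exists_hypersubgraph S :
  S \subset incidence_verts H -> S != set0 ->
  (forall e v, inr e \in S -> v \in psi H e -> inl v \in S) ->
  exists2 K, hypersubgraph K H & incidence_verts K = S.
Proof.
move=> /subsetP SH /set0Pn[z zS] closedS.
pose vs := [set v | inl v \in S]; pose es := [set e | inr e \in S].
have vs0 : vs != set0.
  apply/set0Pn; case: z zS => [v vS|e eS]; first by exists v; rewrite inE.
  have eH : e \in hedges H by rewrite -inr_incidence SH.
  by have /set0Pn[v ve] := H_no_empty eH; exists v; rewrite inE (closedS e).
have psiS e : e \in es -> psi H e \subset vs.
  by rewrite inE => eS; apply/subsetP=> v ve; rewrite inE (closedS e).
exists (Hypergraph vs0 psiS).
  split=> //=; apply/subsetP=> x; rewrite inE => /SH; by rewrite inE_incidence.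
by apply/setP=> -[v|e]; rewrite inE_incidence inE.
Qed.

Lemma hconnectedP K :
  hypersubgraph K H -> hconnected K <-> sconn G (incidence_verts K).
Proof.
move=> KH; have [vKH eKH psiK] := KH; split=> [cK|/sconnP cK].
  have edge e v : e \in hedges K -> v \in psi K e ->
      connect (adj_in G (incidence_verts K)) (inr e) (inl v).
    move=> eK ve; apply: connect1; apply/adj_inP; rewrite !inE_incidence gadj_rl.
    by rewrite eK -psiK // ve (subsetP eKH) // (subsetP (psi_sub eK)).
  have [x xK] := set0Pn _ (hverts_neq0 K).
  have walk y : y \in hverts K ->
      connect (adj_in G (incidence_verts K)) (inl x) (inl y).
    move=> yK; have [->|xy] := eqVneq x y; first exact: connect0.
    have [p wp <-] := cK x y xK yK xy.
    elim: p x {xK xy} wp => [|[e z] p IHp] x /=; first by rewrite connect0.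
    case/andP=> /and4P[eK _ xe ze] /IHp; apply: connect_trans.
    apply: (@connect_trans _ _ (inr e)); last exact: edge.
    by rewrite connect_adj_in_sym edge.
  apply: (@sconn_center _ _ _ (inl x)) => -[y|e]; rewrite inE_incidence.
    exact: walk.
  move=> eK; have /set0Pn[y ye] := no_empty_edge_sub KH eK.
  apply: connect_trans (walk y (subsetP (psi_sub eK) y ye)) _.
  by rewrite connect_adj_in_sym edge.
move=> x y xK yK _.
pose W w := exists2 p, hwalk K x p & last x [seq ev.2 | ev <- p] = w.
(* At an e-vertex, the invariant keeps a vertex [u] of that edge where some hypergraph walk from [x]
   ends. *)
pose Q (z : V + E) :=
  match z with inl w => W w | inr e => exists2 u, u \in psi K e & W u end.
have : Q (inl y); last by [].
apply: connect_invariant (cK (inl x) (inl y) _ _) _; rewrite ?inE_incidence //.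
  move=> [w|e] [w'|e'] /adj_inP[]; rewrite !inE_incidence gadj_incidence //.
    by move=> wK eK /andP[_ we] Ww; exists w => //; rewrite psiK.
  move=> eK w'K /andP[_ w'e] [u ue Wu].
  (* A step of a hypergraph walk joins distinct vertices, so the walk is extended only when [w']
     differs from [u]. *)
  have [<- //|uw'] := eqVneq u w'; have [p wp lp] := Wu.
  exists (rcons p (e, w')); last by rewrite map_rcons last_rcons.
  by rewrite hwalk_rcons wp lp /hadjacent_via eK uw' ue psiK.
by exists [::].
Qed.

(** Gives each side of a separation an edge: a v-vertex of [A] has a neighbour, which is an e-vertex
    and so stays in [A]. *)
Lemma component_edge K v A :
  sconn G (incidence_verts K) -> inl v \in incidence_verts K ->
  A \subset incidence_verts K :\ inl v -> A != set0 ->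
  (forall x y, x \in A -> y \in incidence_verts K -> y != inl v -> gadj G x y -> y \in A) ->
  exists e, inr e \in A.
Proof.
move=> cK vK /subsetP AK /set0Pn[[w wA|e]]; last by exists e.
move=> closedA; have := AK _ wA; rewrite in_setD1 => /andP[wv wK].
have [[u|e] eK] := sconn_neighbour cK wK vK wv; rewrite gadj_incidence // => we.
by exists e; apply: closedA wA eK _ _ => //; rewrite gadj_lr.
Qed.

Lemma separating_vertexP K v :
  hypersubgraph K H -> hconnected K -> v \in hverts K ->
  separating_vertex K v <-> ~~ sconn G (incidence_verts K :\ inl v).
Proof.
move=> KH cK vK; have [vKH eKH psiK] := KH; split.
  case=> K1 [K2 [[sub1 _ /set0Pn[e1 e1K]] [sub2 _ /set0Pn[e2 e2K]]]].
  have [_ _ psi1] := sub1; have [_ _ psi2] := sub2.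
  move=> disj [eqV eqE /setP eqv]; apply/negP=> /sconnP cKv.
  (* With [v] deleted, no walk leaves [K1]: a hyperedge of [K2] meeting [K1] could do so only in
     [v]. *)
  pose Q z : Prop := z \in incidence_verts K1 :\ inl v.
  have : Q (inr e2).
    apply: (connect_invariant (x := inr e1)); last first.
    - by rewrite /Q in_setD1 inE_incidence.
    - by apply: cKv; rewrite in_setD1 inE_incidence eqE inE ?e1K ?e2K ?orbT.
    move=> [w|e] [w'|e'] /adj_inP[]; rewrite /Q !in_setD1 !inE_incidence gadj_incidence //=.
    + move=> /andP[wv wK] e'K /andP[_ we'] /andP[_ w1].
      move: (e'K); rewrite eqE inE => /orP[//|e'2].
      have w2 : w \in hverts K2.
        by rewrite (subsetP (psi_sub e'2)) // psi2 // psiK.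
      have := eqv w; rewrite !inE w1 w2 => /esym/eqP eqw.
      by rewrite eqw eqxx in wv.
    move=> eK /andP[w'v w'K] /andP[_ w'e] e1'; rewrite w'v.
    by rewrite (subsetP (psi_sub e1')) // psi1 // psiK.
  rewrite /Q in_setD1 inE_incidence /= => e21.
  by move/setP/(_ e2): disj; rewrite !inE e21 e2K.
move: cK => /(hconnectedP KH) cK; set S := incidence_verts K.
have vS : inl v \in S by rewrite inE_incidence.
have SH : S \subset incidence_verts H by apply: incidence_sub.
have closedS e w : inr e \in S -> w \in psi H e -> inl w \in S.
  by rewrite !inE_incidence => eK we; rewrite (subsetP (psi_sub eK)) // psiK.
have incS e w : inr e \in S -> w \in psi H e -> gadj G (inl w) (inr e).
  by rewrite inr_incidence gadj_lr => eK ->; rewrite (subsetP eKH).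
case/forall_inPn=> x xS /forall_inPn[y yS xy].
(* [A] is the component of [x] after deleting [v], and [B] below collects all the others. Each side
   together with [v] yields one of the two hypersubgraphs. *)
pose A := [set z | connect (adj_in G (S :\ inl v)) x z].
have AS : A \subset S :\ inl v.
  apply/subsetP=> z; rewrite inE => xz; pose Q z : Prop := z \in S :\ inl v.
  by apply: (connect_invariant (Q := Q)) xz xS => s t /adj_inP[].
have closedA s t : s \in A -> t \in S -> t != inl v -> gadj G s t -> t \in A.
  move=> sA tS tv st; have sS := subsetP AS s sA; move: sA; rewrite !inE => xs.
  apply: connect_trans xs (connect1 _); apply/adj_inP; split=> //.
  by rewrite in_setD1 tv.
pose B := S :\ inl v :\: A.
have BS : B \subset S :\ inl v by apply: subsetDl.
have closedB s t : s \in B -> t \in S -> t != inl v -> gadj G s t -> t \in B.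
  move=> /setDP[sS sA] tS tv st; rewrite in_setD in_setD1 tv tS /= andbT.
  apply: contra sA => tA; case/setD1P: sS => sv sS.
  by apply: closedA tA sS sv _; rewrite gadj_sym.
have sub_S (D : {set V + E}) : D \subset S :\ inl v -> inl v |: D \subset S.
  by move=> DS; rewrite subUset sub1set vS (subset_trans DS) ?subsetDl.
have part (D : {set V + E}) : D \subset S :\ inl v -> D != set0 ->
    (forall s t, s \in D -> t \in S -> t != inl v -> gadj G s t -> t \in D) ->
    exists2 K', incidence_verts K' = inl v |: D &
      [/\ hypersubgraph K' K, hconnected K' & hedges K' != set0].
  move=> DS D0 closedD; have DvS := sub_S D DS.
  have D'S : D \subset S := subset_trans DS (subsetDl _ _).
  have [|||K' K'H vK'] := @exists_hypersubgraph (inl v |: D).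
  - exact: subset_trans DvS SH.
  - by apply/set0Pn; exists (inl v); apply: setU11.
  - move=> e w; rewrite !in_setU1 /= => eD we; have eS := subsetP D'S _ eD.
    have [//|wv] := eqVneq (inl w : V + E) (inl v).
    apply: closedD eD (closedS e w eS we) wv _.
    by rewrite gadj_sym; apply: incS.
  exists K' => //; split.
  - by apply: sub_hypersubgraph K'H KH _; rewrite vK'.
  - by apply/(hconnectedP K'H); rewrite vK'; apply: sconn_components cK vS D'S closedD.
  have [e eD] := component_edge cK vS DS D0 closedD.
  by apply/set0Pn; exists e; rewrite -inr_incidence vK' setU1r.
have A0 : A != set0 by apply/set0Pn; exists x; rewrite inE connect0.
have B0 : B != set0 by apply/set0Pn; exists y; apply/setDP; rewrite yS inE.
have [K1 v1 K1P] := part A AS A0 closedA.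
have [K2 v2 K2P] := part B BS B0 closedB.
have AT z : z \in A -> (z != inl v) && (z \in S).
  by move/(subsetP AS); rewrite in_setD1.
exists K1, K2; split=> //; last split.
- apply/setP=> e; rewrite inE -!inr_incidence v1 v2 !in_setU1 in_setD in_set0 /=.
  by case: (inr e \in A).
- apply/setP=> w; rewrite inE -!inl_incidence v1 v2 !in_setU1 in_setD in_setD1.
  have := AT (inl w); have [-> _|wv] := eqVneq (inl w) _; first by rewrite vS.
  by case: (inl w \in A) => [/(_ isT)|_].
- apply/setP=> e; rewrite inE -!inr_incidence v1 v2 !in_setU1 in_setD in_setD1 /=.
  by have := AT (inr e); case: (inr e \in A) => [/(_ isT)|_].
apply/setP=> w; rewrite in_setI in_set1 -!inl_incidence v1 v2 !in_setU1 in_setD in_setD1.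
have -> : (inl w == inl v :> V + E) = (w == v) by [].
by case: eqVneq => //= _; case: (_ \in A).
Qed.

Lemma nonseparableP K :
  hypersubgraph K H ->
  nonseparable K <-> nocut G (@v_vertex V E) (incidence_verts K).
Proof.
move=> KH; split.
  case=> cK _ sepK; have cS := (hconnectedP KH).1 cK; apply/nocutP; split=> //.
  - exact: incidence_sub.
  - have [x xK] := set0Pn _ (hverts_neq0 K).
    by apply/set0Pn; exists (inl x); rewrite inE_incidence.
  case=> // v _; have [vK|vK] := boolP (v \in hverts K); last first.
    by rewrite (setDidPl _) // disjoint_sym disjoints1 inE_incidence.
  by apply/negPn/negP=> /(separating_vertexP KH cK vK); apply: sepK.
case/nocutP=> _ _ /(hconnectedP KH) cK cut; split=> //.
  exact: no_empty_edge_sub.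
by move=> v vK /(separating_vertexP KH cK vK)/negP; apply; apply: cut.
Qed.

(** The added vertices are v-vertices hanging on e-vertices of [S], and these survive the deletion
    of any v-vertex. *)
Lemma nocut_complete_edges S :
  nocut G (@v_vertex V E) S ->
  exists2 K, hypersubgraph K H &
    S \subset incidence_verts K /\ nocut G (@v_vertex V E) (incidence_verts K).
Proof.
case/nocutP=> SG S0 cS cut.
pose A := S :|: [set x | [exists e, (inr e \in S) && gadj G x (inr e)]].
have SA : S \subset A := subsetUl _ _.
have pend x : x \in A -> x \notin S -> exists2 e, inr e \in S & gadj G x (inr e).
  by rewrite !inE => /orP[->//|/existsP[e /andP[? ?]] _]; exists e.
have AG : A \subset incidence_verts H.
  rewrite subUset SG; apply/subsetP=> x; rewrite inE => /existsP[e /andP[_ xe]].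
  by have /andP[] := gadj_verts xe.
have cA : sconn G A.
  by apply: sconn_pendant SA cS _ S0 => x xA xS; have [e] := pend x xA xS; exists (inr e).
have A0 : A != set0 by apply: contra_neq S0 => A0; apply/eqP; rewrite -subset0 -A0.
have [|K KH vK] := exists_hypersubgraph AG A0.
  move=> e v eA ve; rewrite in_setU inE.
  (* e-vertices are pairwise nonadjacent, so none is added and a single completion is already
     closed. *)
  have eS : inr e \in S.
    by apply/negPn/negP=> eS; have [f _] := pend _ eA eS; rewrite gadj_rr.
  apply/orP; right; apply/existsP; exists e; rewrite eS gadj_lr ve andbT.
  by rewrite -inr_incidence (subsetP SG).
exists K => //; rewrite vK; split=> //; apply/nocutP; split=> //.
(* If nothing but [v] is in [S], there is no e-vertex to hang anything on, so nothing is added. *)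
case=> // v _; have [/eqP Sv0|Sv0] := boolP (S :\ inl v == set0).
  suff -> : A :\ inl v = set0 by apply/sconnP=> x y; rewrite inE.
  apply/setP=> x; rewrite in_setD1 in_set0; apply/andP=> -[xv xA].
  have [xS|xS] := boolP (x \in S).
    by move/setP/(_ x): Sv0; rewrite in_setD1 xv xS inE.
  have [e eS _] := pend x xA xS.
  by move/setP/(_ (inr e)): Sv0; rewrite in_setD1 eS inE.
apply: sconn_pendant (setSD _ SA) (cut (inl v) isT) _ Sv0 => x.
rewrite !in_setD1 => /andP[xv xA]; rewrite xv /= => xS.
by have [e eS xe] := pend x xA xS; exists (inr e); rewrite // in_setD1 eS.
Qed.

(** A larger uncut set need not come from a hypersubgraph, so it is first completed to one that
    does. *)
Lemma hblockP K :
  hypersubgraph K H ->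
  hblock H K <-> maxset (nocut G (@v_vertex V E)) (incidence_verts K).
Proof.
move=> KH; split.
  case=> _ /(nonseparableP KH) ncK maxK; apply/maxsetP; split=> // S ncS KS.
  have [K' K'H [SK' /(nonseparableP K'H) nsK']] := nocut_complete_edges ncS.
  have KK' := sub_hypersubgraph KH K'H (subset_trans KS SK').
  apply/eqP; rewrite eqEsubset KS andbT (subset_trans SK') //.
  exact/incidence_sub/maxK.
case/maxsetP=> ncK maxK; split=> //; first exact/(nonseparableP KH).
move=> K' K'H /(nonseparableP K'H) ncK' /incidence_sub/(maxK _ ncK') eqK.
by apply: sub_hypersubgraph K'H KH _; rewrite eqK.
Qed.

End Subhypergraphs.
End Incidence.

Theorem theorem3p41 (V E : finType) (H H' : hypergraph V E)
    (H_connected : hconnected H) (H_no_empty : no_empty_edge H)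
    (H'_sub : hypersubgraph H' H) :
  hblock H H' <->
  maximal_cluster (incidence_graph H) (incidence_graph H').
Proof.
(* Both sides now speak of the same vertex set of the incidence graph of [H]. *)
rewrite (incidence_induced H'_sub).
apply: (iff_trans (hblockP H_no_empty H'_sub)); apply: iff_sym.
exact/maximal_clusterP/incidence_sub.
Qed.
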